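(* Let $B\subset\mathbb{R}^k$ and $Q\subset\mathbb{R}^n$ be polytopes with facet descriptions $$B=\{x\in\mathbb{R}^k: u_i\cdot x\le b_i,\ i=1,\dots,l\},\qquad Q=\{y\in\mathbb{R}^n: t_j\cdot y\le a_j,\ j=1,\dots,m\}.$$ For each $j\in\{1,\dots,m\}$ let $\phi_j:\mathbb{R}^k\to\mathbb{R}$ be an affine function, and for each $x\in B$ consider the polytope $$Q_x:=\{y\in\mathbb{R}^n: t_j\cdot y\le a_j+\phi_j(x),\ j=1,\dots,m\}.$$ Finally, let $$P:=\{(x,y)\in\mathbb{R}^k\times\mathbb{R}^n: u_i\cdot x\le b_i\ (i=1,\dots,l),\ \ t_j\cdot y\le a_j+\phi_j(x)\ (j=1,\dots,m)\}.$$ 1. If $Q_x$ is normally isomorphic to $Q$ for every $x\in B$, then $P$ is a bundle with fiber $Q$ and base $B$. 2. All bundles arise in this way, modulo a change of bases in $\mathbb{R}^k$, $\mathbb{R}^n$ and $\mathbb{R}^{k+n}$.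
   Context: Two polytopes in the same ambient space are normally isomorphic if they have the same normal fan. For polytopes $P\subset\mathbb{R}^{k+n}$, $B\subset\mathbb{R}^k$, $Q\subset\mathbb{R}^n$, $P$ is a bundle with base $B$ and fiber $Q$ if (i) $P$ is combinatorially equivalent to $B\times Q$, and (ii) there is a short exact sequence of linear maps $0\to\mathbb{R}^n\xrightarrow{i}\mathbb{R}^{k+n}\xrightarrow{\pi}\mathbb{R}^k\to0$ such that $\pi(P)=B$ and for every $x\in B$ the polytope $\pi^{-1}(x)\cap P$ is normally isomorphic to $i(Q)$. Polytopes are assumed full-dimensional in their ambient spaces, and a facet description is an irredundant one (one inequality per facet). *)

(* Defs.v *)
From HB Require Import structures.
From mathcomp Require Import all_boot all_order all_algebra.
From mathcomp Require Import all_classical all_reals all_analysis.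

Set Implicit Arguments.
Unset Strict Implicit.
Unset Printing Implicit Defensive.

Import Order.TTheory GRing.Theory Num.Theory.
Import numFieldNormedType.Exports.

Local Open Scope classical_set_scope.
Local Open Scope ring_scope.

(** Points of R^d are row vectors.  A point (x, y) of R^k x R^n is
    [row_mx x y : 'rV_(k + n)], so that x is its [lsubmx] and y its [rsubmx]. *)

Section Polytopes.
Variable R : realType.

Definition dot (d : nat) (c x : 'rV[R]_d) : R := \sum_(i < d) c 0 i * x 0 i.

Definition affine_fun (d : nat) (f : 'rV[R]_d -> R) : Prop :=
  exists (c : 'rV[R]_d) (e : R), forall x, f x = dot c x + e.

Definition affine_hull (d : nat) (A : set 'rV[R]_d) : set 'rV[R]_d :=
  [set x | exists (r : nat) (p : 'I_r -> 'rV[R]_d) (w : 'I_r -> R),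
     [/\ forall i, A (p i), \sum_(i < r) w i = 1 &
         x = \sum_(i < r) w i *: p i]].

Definition polyhedron (d l : nat) (u : 'I_l -> 'rV[R]_d) (b : 'I_l -> R) :
    set 'rV[R]_d :=
  [set x | forall i, dot (u i) x <= b i].

Definition polytope (d : nat) (P : set 'rV[R]_d) : Prop :=
  (exists (l : nat) (u : 'I_l -> 'rV[R]_d) (b : 'I_l -> R), P = polyhedron u b)
  /\ bounded_set P.

(** In dimension 0 the second clause still forces P to be nonempty, since the
    affine hull of the empty set is empty. *)
Definition full_dim_polytope (d : nat) (P : set 'rV[R]_d) : Prop :=
  polytope P /\ affine_hull P = setT.

(** Irredundancy: dropping any one of the inequalities changes the set.  For a
    full-dimensional P this means exactly one inequality per facet. *)
Definition facet_description (d l : nat) (P : set 'rV[R]_d)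
    (u : 'I_l -> 'rV[R]_d) (b : 'I_l -> R) : Prop :=
  P = polyhedron u b /\
  forall i, P <> [set x | forall j, j != i -> dot (u j) x <= b j].

(** Faces are cut out by valid inequalities; this includes P itself
    (0 <= 0) and the empty face (0 <= 1). *)
Definition face (d : nat) (P F : set 'rV[R]_d) : Prop :=
  exists (c : 'rV[R]_d) (e : R),
    (forall x, P x -> dot c x <= e) /\ F = [set x | P x /\ dot c x = e].

Definition combinatorially_equivalent (d e : nat)
    (P : set 'rV[R]_d) (Q : set 'rV[R]_e) : Prop :=
  exists f : set 'rV[R]_d -> set 'rV[R]_e,
    set_bij [set F | face P F] [set G | face Q G] f /\
    forall F G, face P F -> face P G -> (F `<=` G <-> f F `<=` f G).

(** The functionals whose maximum over P is attained on all of F. *)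
Definition normal_cone (d : nat) (P F : set 'rV[R]_d) : set 'rV[R]_d :=
  [set c | forall x y, F x -> P y -> dot c y <= dot c x].

(** This makes sense for P of any dimension; the cones then all contain the
    functionals that are constant on P. *)
Definition normal_fan (d : nat) (P : set 'rV[R]_d) : set (set 'rV[R]_d) :=
  [set C | exists F, [/\ face P F, F !=set0 & C = normal_cone P F]].

Definition normally_isomorphic (d : nat) (P Q : set 'rV[R]_d) : Prop :=
  normal_fan P = normal_fan Q.

Definition product_set (k n : nat) (B : set 'rV[R]_k) (Q : set 'rV[R]_n) :
    set 'rV[R]_(k + n) :=
  [set z | B (lsubmx z) /\ Q (rsubmx z)].

Definition bundle (k n : nat) (P : set 'rV[R]_(k + n))
    (B : set 'rV[R]_k) (Q : set 'rV[R]_n) : Prop :=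
  [/\ full_dim_polytope P, full_dim_polytope B, full_dim_polytope Q,
      combinatorially_equivalent P (product_set B Q) &
      exists (i : {linear 'rV[R]_n -> 'rV[R]_(k + n)})
             (p : {linear 'rV[R]_(k + n) -> 'rV[R]_k}),
        [/\ injective i, range i = p @^-1` [set 0], range p = setT,
            p @` P = B &
            forall x, B x ->
              normally_isomorphic (p @^-1` [set x] `&` P) (i @` Q)]].

(** Q_x: the polytope Q = polyhedron t a with its right-hand sides shifted by
    phi_j(x). *)
Definition fiber_polytope (k n m : nat) (t : 'I_m -> 'rV[R]_n) (a : 'I_m -> R)
    (phi : 'I_m -> 'rV[R]_k -> R) (x : 'rV[R]_k) : set 'rV[R]_n :=
  [set y | forall j, dot (t j) y <= a j + phi j x].

Definition total_polytope (k n l m : nat) (u : 'I_l -> 'rV[R]_k) (b : 'I_l -> R)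
    (t : 'I_m -> 'rV[R]_n) (a : 'I_m -> R) (phi : 'I_m -> 'rV[R]_k -> R) :
    set 'rV[R]_(k + n) :=
  [set z | (forall i, dot (u i) (lsubmx z) <= b i) /\
           (forall j, dot (t j) (rsubmx z) <= a j + phi j (lsubmx z))].

(** The image of A under the linear map with matrix M, acting on rows; a change
    of basis is the case of an invertible M. *)
Definition mx_image (d : nat) (M : 'M[R]_d) (A : set 'rV[R]_d) :
    set 'rV[R]_d :=
  (fun x => x *m M) @` A.

End Polytopes.

(* Main.v *)
Require Import Defs.
From mathcomp Require Import all_boot all_order all_algebra.
From mathcomp Require Import all_classical all_reals all_analysis.
From mathcomp Require Import ring lra.

Set Implicit Arguments.
Unset Strict Implicit.
Unset Printing Implicit Defensive.

Import Order.TTheory GRing.Theory Num.Theory.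
Import numFieldNormedType.Exports.

Local Open Scope classical_set_scope.
Local Open Scope ring_scope.

(** Everything is read off from the inequalities that are tight (attained) at the
    points of a polyhedron.  A functional maximal at [z] is nonpositive on every
    direction along which the inequalities tight at [z] do not increase
    ([normal_cone_le0]); each fact about normal cones below follows from this
    by testing a well chosen direction.

    The cones of the normal fan of a polyhedron are the normal cones at its
    points ([normal_fanE]).  For an irredundant description of a
    full-dimensional polyhedron, the cone at a relative interior point of a
    facet is the ray of its normal, so a polyhedron with the same fan must
    have all these normals among its own ([fan_contains_normals]).

    From fibers to bundle.  If [Q_x] and [Q] have the same fan, every inequality
    of [Q_x] is therefore somewhere tight.  The tight set at a point [y] is then
    the set of those [j] with [t_j] in the normal cone at [y], so the same tight
    sets occur in [Q_x] and in [Q] ([fan_tight_sets]).  The tight set of [(x, y)]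
    in [P] consists of that of [x] in [B] and that of [y] in [Q_x]; hence [P] and
    the product of [B] and [Q] have the same tight sets.  These determine the
    face lattice ([tight_sets_equivalent]), and give an interior point of [P]
    as well.

    From bundle to fibers.  In coordinates adapted to the exact sequence
    ([exact_splitting]), [P] lies over [B] and its fibers have the fan of [Q].
    Let [P] be given by [N] irredundant inequalities [p_r x + q_r y <= c_r].
    Combinatorial equivalence with the product gives [N <= l + m]
    ([equivalent_facet_count]).  Each facet of [B] accounts for an inequality with
    [q_r = 0] ([base_facet]), each facet normal [t_j] of [Q] for one with [q_r]
    a positive multiple of [t_j] ([fiber_facet]), and all these are distinct.
    So there are no others: only one inequality carries [t_j], and solving it
    for [t_j y] yields a right-hand side that is affine in [x]
    ([bundle_is_total]). *)

Section Bundles.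
Variable R : realType.

(** * The dot product *)

Section Dot.
Context {d : nat}.
Implicit Types (c x y : 'rV[R]_d) (a : R).

Lemma dotE c x : dot c x = (c *m x^T) 0 0.
Proof. by rewrite mxE; apply: eq_bigr => i _; rewrite mxE. Qed.

Lemma dotC c x : dot c x = dot x c.
Proof. by apply: eq_bigr => i _; rewrite mulrC. Qed.

Lemma dotDr c x y : dot c (x + y) = dot c x + dot c y.
Proof. by rewrite !dotE linearD mulmxDr mxE. Qed.

Lemma dotZr c a x : dot c (a *: x) = a * dot c x.
Proof. by rewrite !dotE linearZ -scalemxAr mxE. Qed.

Lemma dotNr c x : dot c (- x) = - dot c x.
Proof. by rewrite -scaleN1r dotZr mulN1r. Qed.

Lemma dotBr c x y : dot c (x - y) = dot c x - dot c y.
Proof. by rewrite dotDr dotNr. Qed.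

Lemma dot0r c : dot c 0 = 0.
Proof. by rewrite -(scale0r 0) dotZr mul0r. Qed.

Lemma dotDl c x y : dot (x + y) c = dot x c + dot y c.
Proof. by rewrite dotC dotDr !(dotC c). Qed.

Lemma dotZl c a x : dot (a *: x) c = a * dot x c.
Proof. by rewrite dotC dotZr (dotC c). Qed.

Lemma dotNl c x : dot (- x) c = - dot x c.
Proof. by rewrite dotC dotNr (dotC c). Qed.

Lemma dot0l c : dot 0 c = 0.
Proof. by rewrite dotC dot0r. Qed.

Lemma dot_suml (I : Type) (r : seq I) (p : pred I) (f : I -> 'rV[R]_d) x :
  dot (\sum_(i <- r | p i) f i) x = \sum_(i <- r | p i) dot (f i) x.
Proof. by apply: (big_morph (fun c => dot c x)) => [c e|]; rewrite ?dotDl ?dot0l. Qed.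

Lemma dot_sumr (I : Type) (r : seq I) (p : pred I) (f : I -> 'rV[R]_d) x :
  dot x (\sum_(i <- r | p i) f i) = \sum_(i <- r | p i) dot x (f i).
Proof. by rewrite dotC dot_suml; apply: eq_bigr => i _; rewrite dotC. Qed.

Lemma dotxx_ge0 x : 0 <= dot x x.
Proof. by apply: sumr_ge0 => i _; rewrite -expr2 sqr_ge0. Qed.

Lemma dotxx_eq0 x : dot x x = 0 -> x = 0.
Proof.
move=> /eqP; rewrite psumr_eq0 => [/allP h|i _]; last by rewrite -expr2 sqr_ge0.
apply/rowP => i; have := h i (mem_index_enum _).
by rewrite /= mulf_eq0 orbb mxE => /eqP.
Qed.

Lemma dotxx_gt0 x : x != 0 -> 0 < dot x x.
Proof.
by move=> x0; rewrite lt_neqAle dotxx_ge0 andbT eq_sym; apply: contra_neq x0 => /dotxx_eq0.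
Qed.

(** If the half space of [t] lies in the half space of [c], testing with the
    component of [c] orthogonal to [t] shows that [c] is a multiple of [t]. *)
Lemma half_space_multiple (t c : 'rV[R]_d) : t != 0 ->
  (forall w, dot t w <= 0 -> dot c w <= 0) ->
  exists2 mu, 0 <= mu & c = mu *: t.
Proof.
move=> t0 h; have tt := dotxx_gt0 t0.
pose mu := dot c t / dot t t; pose w := c - mu *: t.
have tw : dot t w = 0 by rewrite dotBr dotZr (dotC t c) mulfVK ?subrr ?gt_eqF.
have cw : dot c w = dot w w by rewrite {2}/w dotDl dotNl dotZl tw mulr0 subr0.
have /eqP : w = 0.
  apply: dotxx_eq0; apply/eqP; rewrite eq_le dotxx_ge0 andbT -cw.
  by apply: h; rewrite tw.
rewrite subr_eq0 => /eqP cE; exists mu => //.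
have := h (- t); rewrite !dotNr oppr_le0 oppr_le0 => /(_ (ltW tt)) ct.
by rewrite divr_ge0 // ltW.
Qed.

End Dot.

Lemma dot_row_mx k n (a x : 'rV[R]_k) (b y : 'rV[R]_n) :
  dot (row_mx a b) (row_mx x y) = dot a x + dot b y.
Proof. by rewrite !dotE tr_row_mx mul_row_col mxE. Qed.

Lemma dot_mulmx d e (c : 'rV[R]_d) (z : 'rV[R]_e) (M : 'M[R]_(e, d)) :
  dot c (z *m M) = dot (c *m M^T) z.
Proof. by rewrite !dotE trmx_mul mulmxA. Qed.

(** * Points of a polyhedron and their tight inequalities *)

Section Polyhedra.
Context {d l : nat}.
Variables (v : 'I_l -> 'rV[R]_d) (c : 'I_l -> R).
Local Notation P := (polyhedron v c).

Definition tight (z : 'rV[R]_d) (i : 'I_l) : bool := dot (v i) z == c i.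

Lemma not_tight_lt z i : P z -> ~~ tight z i -> dot (v i) z < c i.
Proof. by move=> Pz; rewrite /tight lt_neqAle => ->; exact: Pz. Qed.

Lemma small_multiplier (r s : 'I_l -> R) (p : pred 'I_l) :
  (forall i, p i -> 0 < s i) ->
  exists2 e, 0 < e & forall i, p i -> e * r i <= s i.
Proof.
move=> s0; pose S := 1 + \sum_(i | p i) `|r i| / s i.
have t0 i : p i -> 0 <= `|r i| / s i.
  by move=> pi; rewrite divr_ge0 // ltW // s0.
have S0 : 0 < S by apply: ltr_pwDl => //; apply: sumr_ge0.
(* S dominates each single ratio r i / s i. *)
exists S^-1; first by rewrite invr_gt0.
move=> i pi; rewrite mulrC ler_pdivrMr // mulrC -ler_pdivrMr ?s0 //.
apply: (@le_trans _ _ (`|r i| / s i)).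
  by rewrite ler_pM2r ?invr_gt0 ?s0 // ler_norm.
rewrite /S (bigD1 i) //= addrCA lerDl addr_ge0 // sumr_ge0 // => j /andP[pj _].
exact: t0.
Qed.

(** Only the tight inequalities obstruct a small move away from [z]. *)
Lemma small_step z w : P z -> (forall i, tight z i -> dot (v i) w <= 0) ->
  exists2 e, 0 < e & P (z + e *: w).
Proof.
move=> Pz h.
have [|e e0 he] := @small_multiplier (fun i => dot (v i) w)
    (fun i => c i - dot (v i) z) (fun i => ~~ tight z i).
  by move=> i ti; rewrite subr_gt0 not_tight_lt.
exists e => // i; rewrite dotDr dotZr.
have [ti|/he] := boolP (tight z i); last by rewrite lerBrDl.
by rewrite -[leRHS]addr0 lerD ?Pz // pmulr_rle0 ?h.
Qed.

(** If [f] were positive on [w], a small step along [w] would stay in [P] and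
    increase [f] beyond its maximum. *)
Lemma normal_cone_le0 z f w : P z -> normal_cone P [set z] f ->
  (forall i, tight z i -> dot (v i) w <= 0) -> dot f w <= 0.
Proof.
move=> Pz fz h; have [e e0 Pe] := small_step Pz h.
by have := fz z _ erefl Pe; rewrite dotDr dotZr gerDl pmulr_rle0.
Qed.

Lemma tight_normal_cone z i : tight z i -> normal_cone P [set z] (v i).
Proof. by move=> /eqP ti x y -> Py; rewrite ti. Qed.

Lemma midpoint_tight x y i : P x -> P y ->
  tight (2^-1 *: (x + y)) i = tight x i && tight y i.
Proof.
move=> Px Py; have := Px i; have := Py i.
rewrite /tight dotZr dotDr => hy hx.
apply/eqP/andP => [h|[/eqP -> /eqP ->]]; first by split; apply/eqP; lra.
by field.
Qed.

(** A point of [G] with as few tight inequalities as possible lies in the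
    relative interior of the smallest face containing [G]: averaging it with
    another point of [G] cannot lose a tight inequality. *)
Lemma generic_point (G : set 'rV[R]_d) : G !=set0 -> G `<=` P ->
  (forall x y, G x -> G y -> G (2^-1 *: (x + y))) ->
  exists2 z, G z & forall i, tight z i -> forall x, G x -> tight x i.
Proof.
move=> [x0 Gx0] GP mid.
pose Q n := `[< exists2 z, G z & #|[set i | tight z i]%SET| = n >].
have exQ : exists n, Q n by exists #|[set i | tight x0 i]%SET|; apply/asboolP; exists x0.
have [n /asboolP[z Gz zn] nmin] := ex_minnP exQ.
exists z => // i ti x Gx.
pose y := 2^-1 *: (z + x).
have tyE : [set i | tight y i]%SET = ([set i | tight z i] :&: [set i | tight x i])%SET.
  by apply/setP => j; rewrite !inE midpoint_tight //; exact: GP.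
have : (n <= #|[set i | tight y i]%SET|)%N.
  by apply: nmin; apply/asboolP; exists y => //; apply: mid.
rewrite -zn tyE => le.
have /eqP : ([set i | tight z i] :&: [set i | tight x i] = [set i | tight z i])%SET.
  by apply/eqP; rewrite eqEcard subsetIl le.
move=> /eqP /setP /(_ i); rewrite !inE ti /=; exact.
Qed.

Lemma face_mid F x y : face P F -> F x -> F y -> F (2^-1 *: (x + y)).
Proof.
move=> [f [e [h ->]]] [Px fx] [Py fy]; split.
  by move=> i; have := Px i; have := Py i; rewrite dotZr dotDr; lra.
by rewrite dotZr dotDr fx fy; field.
Qed.

Lemma face_sub F : face P F -> F `<=` P.
Proof. by move=> [f [e [_ ->]]] x []. Qed.

Lemma face_generic F : face P F -> F !=set0 ->
  exists2 z, F z & forall i, tight z i -> forall x, F x -> tight x i.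
Proof.
move=> fF F0; apply: generic_point => //; first exact: face_sub.
by move=> x y; exact: face_mid.
Qed.

Lemma tight_face_valid (p : pred 'I_l) x : P x ->
  dot (\sum_(i | p i) v i) x <= \sum_(i | p i) c i.
Proof. by move=> Px; rewrite dot_suml; apply: ler_sum. Qed.

(** Summing the chosen inequalities: the sum is attained exactly where each of
    them is. *)
Lemma tight_face (p : pred 'I_l) :
  face P [set x | P x /\ forall i, p i -> tight x i].
Proof.
exists (\sum_(i | p i) v i), (\sum_(i | p i) c i); split.
  exact: tight_face_valid.
apply/seteqP; split => x [Px h]; split => //.
  by rewrite dot_suml; apply: eq_bigr => i /h/eqP.
move=> i pi; apply/negP => /negP ti.
suff : dot (\sum_(i | p i) v i) x < \sum_(i | p i) c i by rewrite h ltxx.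
rewrite dot_suml (bigD1 i) //= [ltRHS](bigD1 i) //= ltr_leD ?not_tight_lt //.
by apply: ler_sum.
Qed.

Lemma tight_face1 i : face P [set x | P x /\ tight x i].
Proof.
rewrite (_ : [set x | _] = [set x | P x /\ forall j, pred1 i j -> tight x j]).
  exact: tight_face.
by apply/seteqP; split=> x [Px h]; split=> //; [move=> j /eqP -> | apply: h => /=].
Qed.

Lemma faceT : face P P.
Proof.
by exists 0, 0; split=> [x _|]; rewrite ?dot0l //; apply/seteqP; split=> x //;
  [rewrite /= dot0l|case].
Qed.

Lemma face0 : face P set0.
Proof.
exists 0, 1; split=> [x _|]; first by rewrite dot0l.
by apply/seteqP; split=> x // [_]; rewrite dot0l => /esym/eqP; rewrite oner_eq0.
Qed.

(** The segment from [x] to [z] can be prolonged a little beyond [z] inside [P],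
    so a functional maximal at the inner point [z] is constant on it. *)
Lemma max_transfer f z x : normal_cone P [set z] f -> P z -> P x ->
  (forall i, tight z i -> tight x i) -> dot f x = dot f z.
Proof.
move=> fz Pz Px h; apply/eqP; rewrite eq_le fz //=.
rewrite -subr_le0 -dotBr; apply: normal_cone_le0 Pz fz _ => i ti.
by rewrite dotBr (eqP ti) (eqP (h i ti)) subrr.
Qed.

Lemma face_tight F z x : face P F -> F z -> P x ->
  (forall i, tight z i -> tight x i) -> F x.
Proof.
move=> [f [e [h ->]]] [Pz fz] Px zx; split => //; rewrite -fz.
by apply: max_transfer zx => // _ y -> /h; rewrite fz.
Qed.

(** The normal cone of a face is the one at a generic point of the face, and
    every point is generic in the face cut out by the inequalities tight at
    it.  This replaces faces by points in every argument about fans. *)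
Lemma normal_fanE C :
  normal_fan P C <-> exists2 z, P z & C = normal_cone P [set z].
Proof.
split=> [[F [fF F0 ->]]|[z Pz ->]].
  have [z Fz hz] := face_generic fF F0; exists z; first exact: face_sub Fz.
  apply/seteqP; split=> f hf x y; first by move=> ->; apply: hf.
  move=> Fx Py; rewrite (@max_transfer f z x) //; first exact: hf.
  - exact: face_sub Fz.
  - exact: face_sub Fx.
  - by move=> i ti; apply: hz.
exists [set x | P x /\ forall i, tight z i -> tight x i]; split.
- exact: tight_face.
- by exists z.
- apply/seteqP; split=> f hf x y; last by move=> ->; apply: hf.
  by move=> [Px zx] Py; rewrite (max_transfer hf Pz Px zx); apply: hf.
Qed.

Lemma interior_normal_cone z : P z -> (forall i, ~~ tight z i) ->
  normal_cone P [set z] = [set 0].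
Proof.
move=> Pz nt; apply/seteqP; split=> f; last by move=> -> x y _ _; rewrite !dot0l.
move=> hf; apply: dotxx_eq0; apply/eqP; rewrite eq_le dotxx_ge0 andbT.
by apply: (normal_cone_le0 Pz hf) => i; rewrite (negPf (nt i)).
Qed.

(** If exactly one inequality is tight at [z], the polyhedron is a half space
    near [z]. *)
Lemma facet_normal_cone z i : P z -> v i != 0 ->
  (forall j, tight z j = (j == i)) ->
  normal_cone P [set z] = [set f | exists2 mu, 0 <= mu & f = mu *: v i].
Proof.
move=> Pz vi0 tz; apply/seteqP; split=> f.
  move=> hf; apply: half_space_multiple => // w hw.
  by apply: (normal_cone_le0 Pz hf) => j; rewrite tz => /eqP ->.
move=> [mu mu0 ->] x y -> Py; rewrite !dotZl ler_wpM2l //.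
by have /eqP -> : tight z i by rewrite tz.
Qed.

End Polyhedra.
(** * Facet descriptions *)

Lemma facet_description_exists d l (u : 'I_l -> 'rV[R]_d) (b : 'I_l -> R) :
  exists (l' : nat) (u' : 'I_l' -> 'rV[R]_d) (b' : 'I_l' -> R),
    facet_description (polyhedron u b) u' b'.
Proof.
elim: l u b => [|l IH] u b; first by exists 0, u, b; split => // -[].
have [[i hi]|h] := pselect (exists i,
  polyhedron u b = [set x | forall j, j != i -> dot (u j) x <= b j]); last first.
  by exists l.+1, u, b; split => // i hi; apply: h; exists i.
have [l' [u' [b' h']]] := IH (u \o lift i) (b \o lift i).
exists l', u', b'; rewrite hi; congr facet_description: h'.
apply/seteqP; split=> x hx j; last by apply: hx; rewrite eq_sym neq_lift.
by case: (unliftP i j) => [j' ->|->]; [move=> _; exact: hx | rewrite eqxx].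
Qed.

Lemma facet_description_witness d l P (u : 'I_l -> 'rV[R]_d) (b : 'I_l -> R) i :
  facet_description P u b ->
  exists2 z, b i < dot (u i) z & forall j, j != i -> dot (u j) z <= b j.
Proof.
move=> [PE /(_ i) irr]; apply: contrapT => h; apply: irr; rewrite PE.
apply/seteqP; split=> x hx j; first by move=> _; apply: hx.
have [->|/hx//] := eqVneq j i; rewrite leNgt; apply/negP => lt.
by apply: h; exists x.
Qed.

(** The only consequence of full dimension and irredundancy that is used later:
    a point of the interior, and one in the relative interior of each facet. *)
Definition facet_system d l (u : 'I_l -> 'rV[R]_d) (b : 'I_l -> R) : Prop :=
  (exists2 z, polyhedron u b z & forall i, ~~ tight u b z i) /\
  (forall i, exists2 x, polyhedron u b x & forall j, tight u b x j = (j == i)).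

Lemma affine_hullT_neq0 d (P : set 'rV[R]_d) : affine_hull P = setT -> P !=set0.
Proof.
move=> PT; have : affine_hull P 0 by rewrite PT.
move=> [[|r] [p [w [Pp w1 _]]]]; last by exists (p ord0).
by move/eqP: w1; rewrite big_ord0 eq_sym oner_eq0.
Qed.

(** Any [z] lies on the line through the interior point [x] and a point of [P]
    close to [x] in the direction of [z]. *)
Lemma interior_affine_hull d l (u : 'I_l -> 'rV[R]_d) (b : 'I_l -> R) x :
  polyhedron u b x -> (forall i, ~~ tight u b x i) ->
  affine_hull (polyhedron u b) = setT.
Proof.
move=> Px nt; apply/seteqP; split=> // z _.
have [i ti|e e0 Pe] := @small_step d l u b x (z - x) Px.
  by rewrite (negPf (nt i)) in ti.
exists 2, (fun i => if i == ord0 then x else x + e *: (z - x)),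
  (fun i => if i == ord0 then 1 - e^-1 else e^-1); split.
- by move=> i; case: ifP.
- by rewrite !big_ord_recl big_ord0 /= addr0 subrK.
- rewrite !big_ord_recl big_ord0 /= addr0 scalerDr scalerA mulVf ?gt_eqF //.
  by rewrite scale1r addrA -scalerDl subrK scale1r addrC subrK.
Qed.

(** A generic point of [P] is interior, as an inequality tight on all of [P]
    would be an equation of its affine hull.  A point violating only the [i]-th
    inequality exists by irredundancy; the segment joining it to the interior
    point meets the [i]-th hyperplane strictly inside all other half spaces. *)
Lemma facet_description_system d l P (u : 'I_l -> 'rV[R]_d) (b : 'I_l -> R) :
  affine_hull P = setT -> facet_description P u b -> facet_system u b.
Proof.
move=> PT fd; have PE := fd.1; have P0 := affine_hullT_neq0 PT.
have u0 i : u i != 0.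
  apply/eqP => ui0; have [z + _] := facet_description_witness i fd.
  have [x] := P0; rewrite PE => /(_ i); rewrite ui0 !dot0l => h1 h2.
  by have := le_lt_trans h1 h2; rewrite ltxx.
have [|||z Pz hz] := @generic_point d l u b P => //.
- by rewrite PE.
- move=> x y; rewrite PE => Px Py i; rewrite dotZr dotDr.
  by have := Px i; have := Py i; lra.
rewrite PE in Pz hz.
have nt i : ~~ tight u b z i.
  apply/negP => ti; have hull x : dot (u i) x = b i.
    have : affine_hull P x by rewrite PT.
    rewrite PE => -[r [p [w [Pp w1 ->]]]]; rewrite dot_sumr.
    rewrite (eq_bigr (fun j => w j * b i)) => [|j _].
      by rewrite -mulr_suml w1 mul1r.
    by rewrite dotZr (eqP (hz i ti _ (Pp j))).
  have := dotxx_gt0 (u0 i); rewrite hull -(hull 0) dot0r ltxx; exact.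
split; first by exists z.
move=> i; have [w wi wj] := facet_description_witness i fd.
have zi := not_tight_lt Pz (nt i).
(* the point where the segment from z to w leaves the i-th half space *)
pose s := (b i - dot (u i) z) / (dot (u i) w - dot (u i) z).
have D0 : 0 < dot (u i) w - dot (u i) z by lra.
have s0 : 0 < s by rewrite divr_gt0 // subr_gt0.
have s1 : s < 1 by rewrite ltr_pdivrMr // mul1r; lra.
pose x := z + s *: (w - z).
have xi : dot (u i) x = b i.
  by rewrite dotDr dotZr dotBr /s divfK ?gt_eqF //; ring.
have xj j : j != i -> dot (u j) x < b j.
  move=> /wj hw; have zj := not_tight_lt Pz (nt j).
  by rewrite dotDr dotZr dotBr; nra.
exists x; first by move=> j; have [->|/xj/ltW//] := eqVneq j i; rewrite xi.
by move=> j; rewrite /tight; have [->|/xj/lt_eqF//] := eqVneq j i; rewrite xi eqxx.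
Qed.

Section FacetSystem.
Context {d l : nat}.
Variables (u : 'I_l -> 'rV[R]_d) (b : 'I_l -> R).
Hypothesis fs : facet_system u b.

Lemma facet_system_neq0 i : u i != 0.
Proof.
apply/eqP => ui0; have [[z _ /(_ i) nt] /(_ i)[x _ /(_ i)]] := fs.
by move: nt; rewrite eqxx /tight ui0 !dot0l => /negPf ->.
Qed.

(** Parallel inequalities are tight simultaneously. *)
Lemma facet_system_parallel i j mu : 0 <= mu -> u i = mu *: u j -> i = j.
Proof.
move=> mu0 uE; have [_ fp] := fs.
have [x Px /(_ i)] := fp i; have [y Py yt] := fp j.
rewrite eqxx => /eqP xi; have /eqP yj : tight u b y j by rewrite yt.
apply/eqP; rewrite -yt /tight eq_le Py /= -xi uE !dotZl ler_wpM2l // yj.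
exact: Px.
Qed.

(** The normal cones of the facets are the rays spanned by the facet normals,
    so the fan alone forces every system with the same fan to contain all the
    facet normals, each with an inequality that is somewhere tight. *)
Lemma fan_contains_normals m (q : 'I_m -> 'rV[R]_d) (e : 'I_m -> R) j :
  normal_fan (polyhedron q e) = normal_fan (polyhedron u b) ->
  exists r y, [/\ polyhedron q e y, tight q e y r &
    exists2 mu, 0 < mu & q r = mu *: u j].
Proof.
move=> fE; have [_ /(_ j)[x Px tx]] := fs.
have uj0 := facet_system_neq0 j.
have : normal_fan (polyhedron u b) (normal_cone (polyhedron u b) [set x]).
  by apply/normal_fanE; exists x.
rewrite -fE => /normal_fanE[y Py].
rewrite (facet_normal_cone Px uj0 tx) => CE.
have [/existsP[r /andP[tr qr0]]|none] :=
  boolP [exists r, tight q e y r && (q r != 0)]; last first.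
  (* otherwise y could be moved in the direction of u_j itself *)
  have uj : normal_cone (polyhedron q e) [set y] (u j).
    by rewrite -CE; exists 1; rewrite ?scale1r.
  have := normal_cone_le0 (w := u j) Py uj; rewrite leNgt dotxx_gt0 // => h.
  suff : false by []; apply: h => r tr.
  move: none => /existsPn/(_ r); rewrite tr /= negbK => /eqP ->.
  by rewrite dot0l.
exists r, y; split => //; have := tight_normal_cone tr.
rewrite -CE => -[mu mu0 qE]; exists mu => //.
by rewrite lt_neqAle mu0 andbT; apply: contra_neq qr0 => mu00; rewrite qE -mu00 scale0r.
Qed.

End FacetSystem.

(** * Tight sets and the face lattice *)

Lemma tight_iff_normal d l (v : 'I_l -> 'rV[R]_d) c i x z :
  polyhedron v c x -> tight v c x i -> polyhedron v c z ->
  tight v c z i <-> normal_cone (polyhedron v c) [set z] (v i).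
Proof.
move=> Px /eqP xi Pz; split; first exact: tight_normal_cone.
by move=> h; rewrite /tight eq_le Pz /= -xi; exact: h.
Qed.

(** Once every inequality is somewhere tight, the tight set at a point is the
    set of normals lying in its normal cone; so the fan determines which tight
    sets occur. *)
Lemma fan_tight_sets d m (t : 'I_m -> 'rV[R]_d) (a a' : 'I_m -> R) :
  (forall j, exists2 x, polyhedron t a x & tight t a x j) ->
  (forall j, exists2 x, polyhedron t a' x & tight t a' x j) ->
  normal_fan (polyhedron t a) = normal_fan (polyhedron t a') ->
  forall y, polyhedron t a y ->
  exists2 y', polyhedron t a' y' & forall j, tight t a' y' j = tight t a y j.
Proof.
move=> ta ta' fE y Py.
have : normal_fan (polyhedron t a) (normal_cone (polyhedron t a) [set y]).
  by apply/normal_fanE; exists y.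
rewrite fE => /normal_fanE[y' Py' CE]; exists y' => // j.
have [x Px xj] := ta j; have [x' Px' xj'] := ta' j.
by apply/idP/idP; rewrite (tight_iff_normal Px xj Py) (tight_iff_normal Px' xj' Py') CE.
Qed.

Section TightTransfer.
Context {d e l : nat}.
Variables (v : 'I_l -> 'rV[R]_d) (c : 'I_l -> R).
Variables (v' : 'I_l -> 'rV[R]_e) (c' : 'I_l -> R).
Local Notation P := (polyhedron v c).
Local Notation P' := (polyhedron v' c').

(** Comparing tight sets point by point, rather than through the inequalities
    tight on the whole of [F], sends the empty face to the empty face and makes
    the two transfers symmetric. *)
Definition tight_transfer (F : set 'rV[R]_d) : set 'rV[R]_e :=
  [set z' | P' z' /\ exists2 z, F z & forall i, tight v' c' z' i = tight v c z i].

Lemma tight_transfer_face F :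
  (forall z', P' z' -> exists2 z, P z & forall i, tight v c z i = tight v' c' z' i) ->
  face P F -> face P' (tight_transfer F).
Proof.
move=> h fF; have [F0|F0] := pselect (F !=set0); last first.
  rewrite (_ : tight_transfer F = set0); first exact: face0.
  by apply/seteqP; split=> // z' [_ [z Fz _]]; apply: F0; exists z.
have [z Fz hz] := face_generic fF F0.
rewrite (_ : tight_transfer F =
  [set z' | P' z' /\ forall i, tight v c z i -> tight v' c' z' i]).
  exact: tight_face.
apply/seteqP; split=> z' [Pz'].
  by move=> [z2 Fz2 t2]; split=> // i /hz/(_ _ Fz2); rewrite t2.
move=> tz; split=> //; have [z2 Pz2 t2] := h z' Pz'; exists z2; last by move=> i.
by apply: (face_tight fF Fz Pz2) => i /tz; rewrite t2.
Qed.

End TightTransfer.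

Lemma tight_transferK d e l (v : 'I_l -> 'rV[R]_d) c (v' : 'I_l -> 'rV[R]_e) c' F :
  (forall z, polyhedron v c z ->
     exists2 z', polyhedron v' c' z' & forall i, tight v' c' z' i = tight v c z i) ->
  face (polyhedron v c) F ->
  tight_transfer v' c' v c (tight_transfer v c v' c' F) = F.
Proof.
move=> h fF; apply/seteqP; split=> z.
  move=> [Pz [z' [Pz' [z2 Fz2 t2]] t1]].
  by apply: (face_tight fF Fz2 Pz) => i; rewrite t1 t2.
move=> Fz; have Pz := face_sub fF Fz; have [z' Pz' t'] := h z Pz.
by split=> //; exists z' => //; split=> //; exists z.
Qed.

(** A face is determined by the tight sets of its points, so polyhedra with the
    same tight sets have isomorphic face lattices. *)
Lemma tight_sets_equivalent d e l (v : 'I_l -> 'rV[R]_d) c (v' : 'I_l -> 'rV[R]_e) c' :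
  (forall z, polyhedron v c z ->
     exists2 z', polyhedron v' c' z' & forall i, tight v' c' z' i = tight v c z i) ->
  (forall z', polyhedron v' c' z' ->
     exists2 z, polyhedron v c z & forall i, tight v c z i = tight v' c' z' i) ->
  combinatorially_equivalent (polyhedron v c) (polyhedron v' c').
Proof.
move=> h h'; exists (tight_transfer v c v' c'); split.
  split.
  - by move=> F; apply: tight_transfer_face.
  - move=> F G; rewrite !inE => fF fG fE.
    by rewrite -(tight_transferK h fF) fE tight_transferK.
  - move=> G fG; exists (tight_transfer v' c' v c G).
      exact: tight_transfer_face.
    by rewrite tight_transferK.
have mono d1 d2 (v1 : 'I_l -> 'rV[R]_d1) c1 (v2 : 'I_l -> 'rV[R]_d2) c2 F G :
    F `<=` G -> tight_transfer v1 c1 v2 c2 F `<=` tight_transfer v1 c1 v2 c2 G.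
  by move=> FG z [Pz [z' Fz' t]]; split=> //; exists z' => //; apply: FG.
move=> F G fF fG; split; first exact: mono.
by rewrite -{2}(tight_transferK h fF) -{2}(tight_transferK h fG); apply: mono.
Qed.

(** If nothing were tight at a generic point of [F], that point would be
    interior and [F] would be the whole polyhedron. *)
Lemma proper_face_sub_facet d l (v : 'I_l -> 'rV[R]_d) c F :
  face (polyhedron v c) F -> F !=set0 -> F <> polyhedron v c ->
  exists i, forall x, F x -> tight v c x i.
Proof.
move=> fF F0 FP; have [z Fz hz] := face_generic fF F0.
have [/existsP[i /hz hi]|/existsPn nt] := boolP [exists i, tight v c z i].
  by exists i.
exfalso; apply: FP; apply/seteqP; split; first exact: face_sub.
by move=> x Px; apply: (face_tight fF Fz Px) => i ti; have := nt i; rewrite ti.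
Qed.

(** The facets of [P] are sent to proper nonempty faces, hence into facets of
    [P'], and two facets of [P] cannot go into the same one, as no proper face
    contains both.  Nonemptiness matters: for a point, described by no
    inequality, the empty face is maximal among the proper ones. *)
Lemma equivalent_facet_count d e N L (v : 'I_N -> 'rV[R]_d) c
    (v' : 'I_L -> 'rV[R]_e) c' z' :
  facet_system v c ->
  polyhedron v' c' z' -> (forall i, ~~ tight v' c' z' i) ->
  combinatorially_equivalent (polyhedron v c) (polyhedron v' c') ->
  (N <= L)%N.
Proof.
set P := polyhedron v c; set P' := polyhedron v' c'.
move=> [[z0 Pz0 z0t] fp] Pz' nt' [f [[ff finj fsurj] fmono]].
pose facet i := [set x | P x /\ tight v c x i].
have ffacet i : face P (facet i) := tight_face1 _ _ i.
have fP : face P P := faceT _ _.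
have fP0 : face P set0 := face0 _ _.
have facet_max G i : face P G -> G <> P -> facet i `<=` G -> G `<=` facet i.
  move=> fG GP sub; have [x Px tx] := fp i.
  have Gx : G x by apply: sub; split=> //; rewrite tx.
  have [|j hj] := proper_face_sub_facet fG _ GP; first by exists x.
  have /eqP ji : j == i by rewrite -tx; apply: hj.
  by move=> y Gy; split; [exact: face_sub Gy | rewrite -ji; exact: hj].
have fPE : f P = P'.
  have [X fX fXE] := fsurj P' (faceT _ _).
  apply/seteqP; split; first exact: face_sub (ff _ fP).
  by rewrite -fXE; apply/fmono => //; exact: face_sub.
have sE i : exists s, forall x, f (facet i) x -> tight v' c' x s.
  apply: (proper_face_sub_facet (ff _ (ffacet i))).
    apply: contrapT => /nonemptyPn f0.
    have : f (facet i) `<=` f set0 by rewrite f0.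
    move=> /fmono -/(_ (ffacet i) fP0) sub.
    by have [x Px tx] := fp i; apply: (sub x); split=> //; rewrite tx.
  rewrite -/P' -fPE => /finj; rewrite !inE => /(_ (ffacet i) fP) E.
  by have : facet i z0; [rewrite E | move=> [_]; rewrite (negPf (z0t i))].
pose s i := projT1 (cid (sE i)).
have sP i : forall x, f (facet i) x -> tight v' c' x (s i) := projT2 (cid (sE i)).
suff inj : injective s by have := leq_card s inj; rewrite !card_ord.
move=> i j sij; pose G' := [set x | P' x /\ tight v' c' x (s i)].
have fG' : face P' G' := tight_face1 _ _ _.
have [G fG GE] := fsurj G' fG'.
have sub k : s k = s i -> facet k `<=` G.
  move=> sk; apply/(fmono _ _ (ffacet k) fG); rewrite GE => x fx.
  by split; [exact: face_sub (ff _ (ffacet k)) _ fx | rewrite -sk; apply: sP].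
have GP : G <> P.
  move=> GP; have : G' z' by rewrite -GE GP fPE.
  by move=> [_]; rewrite (negPf (nt' _)).
have [x Px tx] := fp j.
have /(facet_max _ i fG GP (sub i erefl))[_] : G x.
  by apply: (sub j) => //; split=> //; rewrite tx.
by rewrite tx => /eqP.
Qed.

(** * Fans under affine embeddings *)

Section FanEmbedding.
Context {d e : nat}.
Variables (M : 'M[R]_(d, e)) (S : 'M[R]_(e, d)).
Hypothesis MS : M *m S = 1%:M.

Definition embed (s : 'rV[R]_e) (y : 'rV[R]_d) : 'rV[R]_e := y *m M + s.

Lemma embed_normal_cone s A F :
  normal_cone (embed s @` A) (embed s @` F) =
  [set f | normal_cone A F (f *m M^T)].
Proof.
apply/seteqP; split=> f hf.
  move=> x y Fx Ay; rewrite -!dot_mulmx.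
  have := hf (embed s x) (embed s y).
  by rewrite !dotDr lerD2r; apply; [exists x|exists y].
move=> _ _ [x Fx <-] [y Ay <-].
by rewrite !dotDr lerD2r !dot_mulmx; apply: hf.
Qed.

Lemma embed_face s A F :
  face (embed s @` A) F <-> exists2 G, face A G & F = embed s @` G.
Proof.
split=> [[f [r [h ->]]]|[_ [f [r [h ->]]] ->]].
  exists [set x | A x /\ dot (f *m M^T) x = r - dot f s].
    exists (f *m M^T), (r - dot f s); split=> // x Ax.
    by rewrite -dot_mulmx lerBrDr -dotDr; apply: h; exists x.
  apply/seteqP; split=> [_ [[x Ax <-] xr]|_ [x [Ax xr] <-]].
    by exists x => //; split=> //; rewrite -xr dotDr -dot_mulmx addrK.
  by split; [exists x | rewrite dotDr dot_mulmx xr subrK].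
exists (f *m S^T), (r + dot (f *m S^T) s).
have E x : dot (f *m S^T) (embed s x) = dot f x + dot (f *m S^T) s.
  by rewrite dotDr -[X in X + _]dot_mulmx -mulmxA MS mulmx1.
split=> [_ [x Ax <-]|]; first by rewrite E lerD2r; apply: h.
apply/seteqP; split=> [_ [x [Ax xr] <-]|_ [[x Ax <-]]].
  by split; [exists x | rewrite E xr].
by rewrite E => /addIr xr; exists x.
Qed.

Lemma embed_normal_fan s A C :
  normal_fan (embed s @` A) C <->
  exists2 D, normal_fan A D & C = [set f | D (f *m M^T)].
Proof.
split=> [[F [/embed_face[G fG ->] F0 ->]]|[_ [F [fF F0 ->]] ->]].
  exists (normal_cone A G); last exact: embed_normal_cone.
  by exists G; split=> //; case: F0 => _ [x Gx _]; exists x.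
exists (embed s @` F); split; last by rewrite embed_normal_cone.
- by apply/embed_face; exists F.
- by case: F0 => x Fx; exists (embed s x), x.
Qed.

(** Restricting functionals along an embedding is onto, so a fan is determined
    by its pull-back and conversely. *)
Lemma embed_normally_isomorphic s s' A B :
  normally_isomorphic (embed s @` A) (embed s' @` B) <-> normally_isomorphic A B.
Proof.
split=> fE; last first.
  by apply/seteqP; split=> C /embed_normal_fan[D fD ->]; apply/embed_normal_fan;
    exists D => //; rewrite ?fE // -fE.
have pull_inj (C D : set 'rV[R]_d) :
    [set f | C (f *m M^T)] = [set f | D (f *m M^T)] -> C = D.
  move=> E; apply/seteqP; split=> g;
    have := congr1 (fun X => X (g *m S^T)) E;
    by rewrite /= -mulmxA -trmx_mul MS trmx1 mulmx1 => ->.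
apply/seteqP; split=> D fD.
  have : normal_fan (embed s @` A) [set f | D (f *m M^T)].
    by apply/embed_normal_fan; exists D.
  by rewrite fE => /embed_normal_fan[D' fD' /pull_inj ->].
have : normal_fan (embed s' @` B) [set f | D (f *m M^T)].
  by apply/embed_normal_fan; exists D.
by rewrite -fE => /embed_normal_fan[D' fD' /pull_inj ->].
Qed.

End FanEmbedding.

(** * Boundedness *)

Lemma bounded_coord d (A : set 'rV[R]_d) :
  bounded_set A <-> exists M, forall x, A x -> forall i, `|x 0 i| <= M.
Proof.
split.
  move=> [M [_ h]]; exists (M + 1) => x Ax i.
  have := h (M + 1) _ x Ax; rewrite ltrDl ltr01 => /(_ isT) /=.
  rewrite /Num.norm /= mx_normrE => /bigmax_leP[_ /(_ (0, i) isT)]; exact.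
move=> [M h]; exists (Num.max M 0); split; first exact: num_real.
move=> r; rewrite gt_max => /andP[Mr r0] x Ax /=.
rewrite /Num.norm /= mx_normrE; apply/bigmax_leP; split; first exact: ltW.
by move=> [i j] _ /=; rewrite ord1 (le_trans (h x Ax j)) // ltW.
Qed.

(** Shrinking towards an interior point maps any polyhedron with the same
    normals into the bounded one. *)
Lemma bounded_shift d m (t : 'I_m -> 'rV[R]_d) (a a' : 'I_m -> R) y0 :
  polyhedron t a y0 -> (forall j, ~~ tight t a y0 j) ->
  bounded_set (polyhedron t a) -> bounded_set (polyhedron t a').
Proof.
move=> Py0 nt /bounded_coord[M hM].
have [j _|e e0 he] := @small_multiplier m (fun j => a' j - dot (t j) y0)
    (fun j => a j - dot (t j) y0) predT.
  by rewrite subr_gt0 not_tight_lt.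
apply/bounded_coord; exists ((M + M) / e + M) => y hy i.
have Qy : polyhedron t a (y0 + e *: (y - y0)).
  move=> j; rewrite dotDr dotZr dotBr; have := he j isT.
  have : e * (dot (t j) y - dot (t j) y0) <= e * (a' j - dot (t j) y0).
    by rewrite ler_pM2l // lerD2r.
  by lra.
have h0 := hM _ Py0 i; have := hM _ Qy i; rewrite !mxE => h1.
have -> : y 0 i = e^-1 * ((y0 0 i + e * (y 0 i - y0 0 i)) - y0 0 i) + y0 0 i.
  by field; rewrite gt_eqF.
rewrite (le_trans (ler_normD _ _)) // lerD // normrM gtr0_norm ?invr_gt0 //.
rewrite mulrC ler_pM2r ?invr_gt0 // (le_trans (ler_normB _ _)) //.
exact: lerD.
Qed.

Lemma dot_bound d (f x : 'rV[R]_d) M :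
  (forall i, `|x 0 i| <= M) -> dot f x <= (\sum_i `|f 0 i|) * M.
Proof.
move=> h; rewrite mulr_suml; apply: ler_sum => i _.
by rewrite (le_trans (ler_norm _)) // normrM ler_wpM2l.
Qed.

(** * The total polytope as a polyhedron *)

Definition catf T l m (f : 'I_l -> T) (g : 'I_m -> T) (i : 'I_(l + m)) : T :=
  match fintype.split i with inl i => f i | inr j => g j end.

Lemma catf_lshift T l m (f : 'I_l -> T) (g : 'I_m -> T) i :
  catf f g (lshift m i) = f i.
Proof. by rewrite /catf (unsplitK (inl i)). Qed.

Lemma catf_rshift T l m (f : 'I_l -> T) (g : 'I_m -> T) j :
  catf f g (rshift l j) = g j.
Proof. by rewrite /catf (unsplitK (inr j)). Qed.

Lemma forall_ord_add l m (p : 'I_(l + m) -> Prop) :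
  (forall i, p (lshift m i)) -> (forall j, p (rshift l j)) -> forall i, p i.
Proof. by move=> hl hr i; case: (split_ordP i) => j ->. Qed.

Section Total.
Context {k n l m : nat}.
Variables (u : 'I_l -> 'rV[R]_k) (b : 'I_l -> R).
Variables (t : 'I_m -> 'rV[R]_n) (a : 'I_m -> R).

(** The inequalities of the total polytope when [phi_j(x) = g_j x + e_j]. *)
Definition total_normal (g : 'I_m -> 'rV[R]_k) : 'I_(l + m) -> 'rV[R]_(k + n) :=
  catf (fun i => row_mx (u i) 0) (fun j => row_mx (- g j) (t j)).

Definition total_bound (e : 'I_m -> R) : 'I_(l + m) -> R :=
  catf b (fun j => a j + e j).

Variables (phi : 'I_m -> 'rV[R]_k -> R).

Lemma total_row_mx x y : total_polytope u b t a phi (row_mx x y) <->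
  polyhedron u b x /\ fiber_polytope t a phi x y.
Proof. by rewrite /= /total_polytope /= row_mxKl row_mxKr. Qed.

Variables (g : 'I_m -> 'rV[R]_k) (e : 'I_m -> R).
Hypothesis phiE : forall j x, phi j x = dot (g j) x + e j.

Lemma total_tight_base x y i :
  tight (total_normal g) (total_bound e) (row_mx x y) (lshift m i) = tight u b x i.
Proof.
by rewrite /tight /total_normal /total_bound !catf_lshift dot_row_mx dot0l addr0.
Qed.

Lemma total_tight_fiber x y j :
  tight (total_normal g) (total_bound e) (row_mx x y) (rshift l j) =
  tight t (fun j => a j + phi j x) y j.
Proof.
rewrite /tight /total_normal /total_bound !catf_rshift dot_row_mx dotNl phiE.
by rewrite addrC subr_eq -addrA [e j + _]addrC.
Qed.

Lemma total_polyhedron :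
  total_polytope u b t a phi = polyhedron (total_normal g) (total_bound e).
Proof.
apply/seteqP; split=> z; rewrite -[z]hsubmxK.
  move=> /total_row_mx[hu ht]; apply: forall_ord_add => i;
    rewrite /total_normal /total_bound ?catf_lshift ?catf_rshift dot_row_mx.
    by rewrite dot0l addr0.
  by rewrite dotNl; have := ht i; rewrite phiE; lra.
move=> h; apply/total_row_mx; split=> i.
  by have := h (lshift m i);
    rewrite /total_normal /total_bound !catf_lshift dot_row_mx dot0l addr0.
have := h (rshift l i).
by rewrite /total_normal /total_bound !catf_rshift dot_row_mx dotNl phiE; lra.
Qed.

End Total.

Lemma product_total k n l m (u : 'I_l -> 'rV[R]_k) b (t : 'I_m -> 'rV[R]_n) a :
  product_set (polyhedron u b) (polyhedron t a) =
  total_polytope u b t a (fun _ _ => 0).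
Proof.
by apply/seteqP; split=> z [hu ht]; split=> // j; have := ht j; rewrite addr0.
Qed.

Lemma product_polyhedron k n l m (u : 'I_l -> 'rV[R]_k) b (t : 'I_m -> 'rV[R]_n) a :
  product_set (polyhedron u b) (polyhedron t a) =
  polyhedron (total_normal u t (fun=> 0)) (total_bound b a (fun=> 0)).
Proof.
by rewrite product_total; apply: total_polyhedron => j x; rewrite dot0l addr0.
Qed.

Lemma product_tight_fiber k n l m (u : 'I_l -> 'rV[R]_k) b
    (t : 'I_m -> 'rV[R]_n) a x y j :
  tight (total_normal u t (fun=> 0)) (total_bound b a (fun=> 0))
    (row_mx x y) (rshift l j) = tight t a y j.
Proof.
rewrite (@total_tight_fiber _ _ _ _ u b t a (fun _ _ => 0)) /tight ?addr0 // => j' x'.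
by rewrite dot0l addr0.
Qed.

(** * From normally isomorphic fibers to a bundle *)

Section TotalIsBundle.
Context {k n l m : nat}.
Variables (u : 'I_l -> 'rV[R]_k) (b : 'I_l -> R).
Variables (t : 'I_m -> 'rV[R]_n) (a : 'I_m -> R).
Variables (phi : 'I_m -> 'rV[R]_k -> R).
Local Notation B := (polyhedron u b).
Local Notation Q := (polyhedron t a).
Local Notation P := (total_polytope u b t a phi).
Hypotheses (fdB : full_dim_polytope B) (fdQ : full_dim_polytope Q).
Hypotheses (facB : facet_system u b) (facQ : facet_system t a).
Hypothesis aff : forall j, affine_fun (phi j).
Hypothesis fan : forall x, B x -> normally_isomorphic (fiber_polytope t a phi x) Q.

(** No inequality of a fiber becomes redundant: its fan contains all the facet
    normals of [Q]. *)
Lemma fiber_tight x j : B x ->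
  exists2 y, fiber_polytope t a phi x y & tight t (fun j => a j + phi j x) y j.
Proof.
move=> Bx; have [r [y [Py ty [mu mu0 tE]]]] := fan_contains_normals facQ j (fan Bx).
by exists y => //; rewrite -(facet_system_parallel facQ (ltW mu0) tE).
Qed.

Lemma base_fiber_tight j : exists2 y, Q y & tight t a y j.
Proof. by have [_ /(_ j)[y Qy ty]] := facQ; exists y; rewrite ?ty. Qed.

Lemma fiber_to_Q x y : B x -> fiber_polytope t a phi x y ->
  exists2 y', Q y' & forall j, tight t a y' j = tight t (fun j => a j + phi j x) y j.
Proof.
move=> Bx; apply: fan_tight_sets; last exact: fan.
  by move=> j; apply: fiber_tight.
exact: base_fiber_tight.
Qed.

Lemma Q_to_fiber x y : B x -> Q y ->
  exists2 y', fiber_polytope t a phi x y' &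
    forall j, tight t (fun j => a j + phi j x) y' j = tight t a y j.
Proof.
move=> Bx; apply: (fan_tight_sets base_fiber_tight); last exact/esym/fan.
by move=> j; apply: fiber_tight.
Qed.

Lemma total_coefficients :
  exists (g : 'I_m -> 'rV[R]_k) (e : 'I_m -> R),
    forall j x, phi j x = dot (g j) x + e j.
Proof. by have [g /choice[e h]] := choice aff; exists g, e. Qed.

Lemma total_full_dim : full_dim_polytope P.
Proof.
have [g [e phiE]] := total_coefficients.
have [[x0 Bx0 x0t] _] := facB; have [[y0 Qy0 y0t] _] := facQ.
have PE := total_polyhedron u b t a phiE.
split; last first.
  have [y Fy ty] := Q_to_fiber Bx0 Qy0.
  rewrite PE; apply: (@interior_affine_hull _ _ _ _ (row_mx x0 y)).
    by rewrite -PE; apply/total_row_mx.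
  apply: forall_ord_add => i; first by rewrite total_tight_base.
  by rewrite (total_tight_fiber _ _ _ _ phiE) ty.
split; first by exists (l + m)%N, (total_normal u t g), (total_bound b a e).
have /bounded_coord[M hM] := fdB.1.2.
(* a bound for phi_j on B *)
pose a' j := a j + ((\sum_i `|g j 0 i|) * M + e j).
have /bounded_coord[M' hM'] := bounded_shift a' Qy0 y0t fdQ.1.2.
apply/bounded_coord; exists (Num.max M M') => z.
rewrite -[z]hsubmxK => /total_row_mx[Bx Fy]; apply: forall_ord_add => i.
  by rewrite row_mxEl le_max hM.
rewrite row_mxEr le_max hM' ?orbT // => j.
by rewrite (le_trans (Fy j)) // lerD2l phiE lerD2r dot_bound //; exact: hM.
Qed.

Lemma total_equivalent : combinatorially_equivalent P (product_set B Q).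
Proof.
have [g [e phiE]] := total_coefficients.
rewrite product_polyhedron (total_polyhedron u b t a phiE).
apply: tight_sets_equivalent.
  move=> z; rewrite -(total_polyhedron _ _ _ _ phiE) -product_polyhedron.
  rewrite -[z]hsubmxK => /total_row_mx[Bx Fy].
  have [y' Qy' ty'] := fiber_to_Q Bx Fy; exists (row_mx (lsubmx z) y').
    by split; rewrite ?row_mxKl ?row_mxKr.
  apply: forall_ord_add => i; first by rewrite !total_tight_base.
  by rewrite product_tight_fiber (total_tight_fiber _ _ _ _ phiE) ty'.
move=> z; rewrite -(total_polyhedron _ _ _ _ phiE) -product_polyhedron.
rewrite -[z]hsubmxK => -[]; rewrite row_mxKl row_mxKr => Bx Qy.
have [y' Fy' ty'] := Q_to_fiber Bx Qy; exists (row_mx (lsubmx z) y').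
  exact/total_row_mx.
apply: forall_ord_add => i; first by rewrite !total_tight_base.
by rewrite product_tight_fiber (total_tight_fiber _ _ _ _ phiE) ty'.
Qed.

Lemma total_bundle : bundle P B Q.
Proof.
have [[y0 Qy0 _] _] := facQ.
pose I : 'M[R]_(n, k + n) := row_mx 0 1%:M.
pose S : 'M[R]_(k + n, n) := col_mx 0 1%:M.
pose A : 'M[R]_(k + n, k) := col_mx 1%:M 0.
have IS : I *m S = 1%:M by rewrite mul_row_col mul0mx mulmx1 add0r.
have AE z : z *m A = lsubmx z.
  by rewrite -{1}[z]hsubmxK mul_row_col mulmx1 mulmx0 addr0.
have IE y : y *m I = row_mx 0 y by rewrite mul_mx_row mulmx0 mulmx1.
split=> //; [exact: total_full_dim | exact: total_equivalent|].
exists (mulmxr I), (mulmxr A); split.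
- by move=> x y /= /(congr1 (mulmxr S)) /=; rewrite -!mulmxA IS !mulmx1.
- apply/seteqP; split=> [_ [y _ <-]|z] /=; first by rewrite AE IE row_mxKl.
  by rewrite AE => z0; exists (rsubmx z); rewrite // IE -z0 hsubmxK.
- apply/seteqP; split=> // x _; exists (row_mx x 0); rewrite //= AE.
  by rewrite row_mxKl.
- apply/seteqP; split=> [_ [z [Bx _] <-]|x Bx] /=; first by rewrite AE.
  have [y Fy _] := Q_to_fiber Bx Qy0; exists (row_mx x y); last first.
    by rewrite /= AE row_mxKl.
  exact/total_row_mx.
- move=> x Bx.
  rewrite (_ : _ `&` _ = embed I (row_mx x 0) @` fiber_polytope t a phi x).
    rewrite (_ : mulmxr I @` Q = embed I 0 @` Q).
      by apply/(embed_normally_isomorphic IS); apply: fan.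
    by congr image; apply/funext => y; rewrite /embed addr0.
  have E y : embed I (row_mx x 0) y = row_mx x y.
    by rewrite /embed IE add_row_mx add0r addr0.
  apply/seteqP; split=> [z [/=]|_ [y Fy <-]].
    rewrite AE => zx; rewrite -[z]hsubmxK => /total_row_mx[_ Fy].
    by exists (rsubmx z); rewrite -?zx // zx E.
  by rewrite E; split; [rewrite /= AE row_mxKl | apply/total_row_mx].
Qed.

End TotalIsBundle.

(** * The facets of a bundle *)

Section BundleFacets.
Context {k n l m N : nat}.
Variables (u : 'I_l -> 'rV[R]_k) (b : 'I_l -> R).
Variables (t : 'I_m -> 'rV[R]_n) (a : 'I_m -> R).
Variables (p : 'I_N -> 'rV[R]_k) (q : 'I_N -> 'rV[R]_n) (c : 'I_N -> R).
Local Notation B := (polyhedron u b).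
Local Notation Q := (polyhedron t a).
Let v r := row_mx (p r) (q r).
Let fiber x := polyhedron q (fun r => c r - dot (p r) x).
Hypotheses (facB : facet_system u b) (facQ : facet_system t a).
Hypothesis v0 : forall r, v r != 0.
Hypothesis base : forall x, B x <-> fiber x !=set0.
Hypothesis fan : forall x, B x -> normally_isomorphic (fiber x) Q.

Lemma fiberE x y : fiber x y <-> polyhedron v c (row_mx x y).
Proof.
by split=> h r; have := h r; rewrite /v dot_row_mx; rewrite lerBrDl.
Qed.

(** The fan of [Q] contains the cone {0}, so a functional constant on a fiber
    vanishes. *)
Lemma constant_on_fiber x f r : B x -> (forall y, fiber x y -> dot f y = r) -> f = 0.
Proof.
move=> Bx cst; have [[y0 Qy0 y0t] _] := facQ.
have : normal_fan Q (normal_cone Q [set y0]) by apply/normal_fanE; exists y0.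
rewrite -(fan Bx) (interior_normal_cone Qy0 y0t) => /normal_fanE[y Fy CE].
suff : [set 0] f by [].
by rewrite CE => y1 y2 -> Fy2; rewrite !cst.
Qed.

(** The part of [P] above a facet of [B] is a face with full-dimensional fibers,
    so an inequality of [P] that is tight on all of it involves the base
    coordinates only, and is the inequality of that facet. *)
Lemma base_facet i : exists r mu,
  [/\ 0 < mu, p r = mu *: u i, q r = 0 & c r = mu * b i].
Proof.
have ui0 := facet_system_neq0 facB i.
have [_ /(_ i)[x Bx tx]] := facB.
have /eqP xi : tight u b x i by rewrite tx.
have uE z : dot (row_mx (u i) (0 : 'rV[R]_n)) z = dot (u i) (lsubmx z).
  by rewrite -{1}[z]hsubmxK dot_row_mx dot0l addr0.
have baseP z : polyhedron v c z -> B (lsubmx z).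
  by move=> Pz; apply/base; exists (rsubmx z); apply/fiberE; rewrite hsubmxK.
pose F := [set z | polyhedron v c z /\ dot (row_mx (u i) (0 : 'rV[R]_n)) z = b i].
have fF : face (polyhedron v c) F.
  by exists (row_mx (u i) 0), (b i); split=> // z /baseP; rewrite uE; apply.
have Fx y : fiber x y -> F (row_mx x y).
  by move=> /fiberE Py; split; rewrite // uE row_mxKl.
have [y Fy] := (base x).1 Bx.
have [|z Fz hz] := face_generic fF; first by exists (row_mx x y); apply: Fx.
have [r tr] : exists r, tight v c z r.
  apply/existsP; apply: contrapT => /negP/existsPn nt.
  (* otherwise z could be moved across the facet of B *)
  have [r tr|e e0] := @small_step _ _ v c z (row_mx (u i) 0) Fz.1.
    by have := nt r; rewrite tr.
  move=> /baseP/(_ i); rewrite -uE dotDr dotZr Fz.2 gerDl.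
  by rewrite dot_row_mx dot0l addr0 pmulr_rle0 // leNgt dotxx_gt0.
have tfib y' : fiber x y' -> dot (p r) x + dot (q r) y' = c r.
  by move=> /Fx/(hz r tr)/eqP; rewrite dot_row_mx.
have qr0 : q r = 0.
  apply: (@constant_on_fiber x _ (c r - dot (p r) x)) => // y' /tfib <-.
  by rewrite addrAC subrr add0r.
have pr x' : B x' -> dot (p r) x' <= c r.
  by move=> /base[y' /(_ r)]; rewrite qr0 dot0l subr_ge0.
have prx : dot (p r) x = c r by rewrite -(tfib y) // qr0 dot0l addr0.
have : normal_cone B [set x] (p r) by move=> _ x' -> /pr; rewrite prx.
rewrite (facet_normal_cone Bx ui0 tx) => -[mu mu0 pE].
exists r, mu; split=> //; last by rewrite -prx pE dotZl xi.
rewrite lt_neqAle mu0 andbT; apply: contra_neq (v0 r) => mu00.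
by rewrite /v qr0 pE -mu00 scale0r row_mx0.
Qed.

Lemma fiber_facet j : exists r mu, 0 < mu /\ q r = mu *: t j.
Proof.
have [[x Bx _] _] := facB.
by have [r [_ [_ _ [mu mu0 qE]]]] := fan_contains_normals facQ j (fan Bx); exists r, mu.
Qed.

(** Distinct facets of [B] and [Q] come from distinct inequalities of [P]; when
    [P] has no more than [l + m] of them there is no other one, and each facet
    of [Q] is carried by a single inequality of [P], affine in [x]. *)
Lemma bundle_is_total : (N <= l + m)%N ->
  exists phi : 'I_m -> 'rV[R]_k -> R,
    (forall j, affine_fun (phi j)) /\
    forall x y, fiber x y <-> B x /\ fiber_polytope t a phi x y.
Proof.
move=> Nlm.
have [s /choice[mu smu]] := choice base_facet.
have [s' /choice[nu snu]] := choice fiber_facet.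
have disj i j : s i <> s' j.
  have [_ _ qi _] := smu i; have [nj qj] := snu j => E.
  move/eqP: qj; rewrite -E qi eq_sym scaler_eq0 gt_eqF //=.
  exact/negP/(facet_system_neq0 facQ).
have inj : injective (catf s s').
  apply: forall_ord_add => i; apply: forall_ord_add => j;
    rewrite ?catf_lshift ?catf_rshift => E.
  - have [mi pi _ _] := smu i; have [mj pj _ _] := smu j.
    congr lshift; apply: (facet_system_parallel facB (mu := (mu i)^-1 * mu j)).
      by rewrite mulr_ge0 ?invr_ge0 // ltW.
    by rewrite -scalerA -pj -E pi scalerA mulVf ?scale1r // gt_eqF.
  - by have := disj _ _ E.
  - by have := disj _ _ (esym E).
  - have [mi qi] := snu i; have [mj qj] := snu j.
    congr rshift; apply: (facet_system_parallel facQ (mu := (nu i)^-1 * nu j)).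
      by rewrite mulr_ge0 ?invr_ge0 // ltW.
    by rewrite -scalerA -qj -E qi scalerA mulVf ?scale1r // gt_eqF.
have onto r : exists i, r = catf s s' i.
  have := inj_card_onto inj; rewrite !card_ord => /(_ Nlm r)/codomP[i ->].
  by exists i.
pose phi j x := (c (s' j) - dot (p (s' j)) x) / nu j - a j.
have phiE x y j : (dot (t j) y <= a j + phi j x) =
    (dot (q (s' j)) y <= c (s' j) - dot (p (s' j)) x).
  have [nj qj] := snu j.
  by rewrite /phi addrC subrK ler_pdivlMr // qj dotZl mulrC.
exists phi; split.
  move=> j; exists (- (nu j)^-1 *: p (s' j)), (c (s' j) / nu j - a j) => x.
  by rewrite /phi dotZl; ring.
move=> x y; split=> [Fy|[Bx Fy]].
  by split; [apply/base; exists y | move=> j; rewrite phiE; apply: Fy].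
move=> r; have [i ->] := onto r; move: i {r}; apply: forall_ord_add => i.
  rewrite catf_lshift; have [mi -> -> ->] := smu i.
  by rewrite dot0l dotZl -mulrBr mulr_ge0 ?(ltW mi) // subr_ge0.
by rewrite catf_rshift -phiE; apply: Fy.
Qed.

End BundleFacets.

(** * Adapted coordinates *)

Lemma mx_image1 d (A : set 'rV[R]_d) : mx_image 1%:M A = A.
Proof.
apply/seteqP; split=> [_ [x Ax <-]|x Ax]; first by rewrite mulmx1.
by exists x; rewrite ?mulmx1.
Qed.

(** The rows of [S] form a section of [p] and those of [I] a basis of its kernel.
    A vector with coordinates [(x, y)] in the joint basis lies over [x] and, up
    to the translation by [x *m S], is the image of [y]. *)
Lemma exact_splitting k n (i : {linear 'rV[R]_n -> 'rV[R]_(k + n)})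
    (p : {linear 'rV[R]_(k + n) -> 'rV[R]_k}) :
  injective i -> range i = p @^-1` [set 0] -> range p = setT ->
  exists (S : 'M[R]_(k, k + n)) (I : 'M[R]_(n, k + n)) (I' : 'M[R]_(k + n, n)),
    [/\ col_mx S I \in unitmx, I *m I' = 1%:M, forall y, y *m I = i y &
        forall x y, p (x *m S + y *m I) = x].
Proof.
move=> inj exact surj.
have sec x : exists z, p z = x.
  by have : range p x by [rewrite surj]; move=> [z _ <-]; exists z.
have [g gK] := choice sec.
pose S : 'M[R]_(k, k + n) := \matrix_j g (row j 1%:M).
pose I := lin1_mx i.
have IE y : y *m I = i y by rewrite mul_rV_lin1.
have SA : S *m lin1_mx p = 1%:M.
  by apply/row_matrixP => j; rewrite row_mul rowK mul_rV_lin1 gK.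
have pS x y : p (x *m S + y *m I) = x.
  rewrite linearD /= IE -[p (x *m S)]mul_rV_lin1 -mulmxA SA mulmx1.
  have -> : p (i y) = 0 by have : (p @^-1` [set 0]) (i y) by rewrite -exact; exists y.
  by rewrite addr0.
have /row_freeP[I' II'] : row_free I.
  by apply: inj_row_free => y; rewrite IE -(linear0 i) => /inj.
exists S, I, I'; split=> //; rewrite -row_free_unit; apply: inj_row_free => z.
rewrite -[z]hsubmxK mul_row_col => E.
have x0 : lsubmx z = 0 by rewrite -(pS (lsubmx z) (rsubmx z)) E linear0.
move: E; rewrite x0 mul0mx add0r => /(congr1 (mulmxr I')) /=.
by rewrite -mulmxA II' mulmx1 mul0mx => ->; rewrite row_mx0.
Qed.

(** Only the ambient space of [P] needs new coordinates: the exact sequence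
    already identifies the base and the fiber with those of [B] and [Q]. *)
Lemma bundle_change_of_basis k n (P : set 'rV[R]_(k + n)) (B : set 'rV[R]_k)
    (Q : set 'rV[R]_n) : bundle P B Q ->
  exists2 MP : 'M[R]_(k + n), MP \in unitmx &
  exists (l m : nat)
         (u : 'I_l -> 'rV[R]_k) (b : 'I_l -> R)
         (t : 'I_m -> 'rV[R]_n) (a : 'I_m -> R)
         (phi : 'I_m -> 'rV[R]_k -> R),
    [/\ facet_description B u b, facet_description Q t a,
        forall j, affine_fun (phi j),
        forall x, B x -> normally_isomorphic (fiber_polytope t a phi x) Q &
        mx_image MP P = total_polytope u b t a phi].
Proof.
move=> [[[P_poly _] PT] [[B_poly _] BT] [[Q_poly _] QT] equiv].
move=> [i [p [inj exact surj pP fan]]].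
have [lP [vP [cP {}P_poly]]] := P_poly.
have [lB [uB [bB {}B_poly]]] := B_poly.
have [lQ [tQ [aQ {}Q_poly]]] := Q_poly.
have [N [v [c]]] := facet_description_exists vP cP; rewrite -P_poly => fdP.
have [l [u [b]]] := facet_description_exists uB bB; rewrite -B_poly => fdB.
have [m [t [a]]] := facet_description_exists tQ aQ; rewrite -Q_poly => fdQ.
have fsP := facet_description_system PT fdP.
have fsB := facet_description_system BT fdB.
have fsQ := facet_description_system QT fdQ.
have [PE BE QE] : [/\ P = polyhedron v c, B = polyhedron u b & Q = polyhedron t a].
  by split; [exact: fdP.1 | exact: fdB.1 | exact: fdQ.1].
have Nlm : (N <= l + m)%N.
  move: equiv; rewrite PE BE QE product_polyhedron.
  have [[x Bx xt] _] := fsB; have [[y Qy yt] _] := fsQ.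
  apply: (equivalent_facet_count (z' := row_mx x y) fsP).
    by rewrite -product_polyhedron; split; rewrite ?row_mxKl ?row_mxKr.
  apply: forall_ord_add => j; first by rewrite total_tight_base.
  by rewrite product_tight_fiber.
have [S [I [I' [W II' IE pS]]]] := exact_splitting inj exact surj.
pose vp r := v r *m S^T; pose vq r := v r *m I^T.
have coordE x y r : dot (v r) (x *m S + y *m I) = dot (vp r) x + dot (vq r) y.
  by rewrite dotDr !dot_mulmx.
have fiberP x y :
    polyhedron vq (fun r => c r - dot (vp r) x) y <-> P (x *m S + y *m I).
  by rewrite PE; split=> h r; have := h r; rewrite coordE lerBrDl.
have splitP z : exists y, z = p z *m S + y *m I.
  have : range i (z - p z *m S).
    rewrite exact /= linearB /=; have := pS (p z) 0.
    by rewrite mul0mx addr0 => ->; rewrite subrr.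
  by move=> [y _ yE]; exists y; rewrite IE yE addrC subrK.
have base x : polyhedron u b x <->
    polyhedron vq (fun r => c r - dot (vp r) x) !=set0.
  rewrite -BE -pP; split=> [[z Pz zx]|[y /fiberP Py]].
    by have [y zE] := splitP z; exists y; apply/fiberP; rewrite -zx -zE.
  by exists (x *m S + y *m I).
have fibers x : polyhedron u b x ->
    normally_isomorphic (polyhedron vq (fun r => c r - dot (vp r) x)) (polyhedron t a).
  rewrite -BE => /fan fx; rewrite -QE.
  apply/(embed_normally_isomorphic II' (x *m S) 0); move: fx.
  rewrite (_ : i @` Q = embed I 0 @` Q); last first.
    by congr image; apply/funext => y; rewrite /embed addr0 IE.
  congr normally_isomorphic; apply/seteqP; split=> [z [/= zx Pz]|_ [y /fiberP Py <-]].
    have [y zE] := splitP z; rewrite zx in zE.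
    by exists y; [apply/fiberP; rewrite -zE | rewrite /embed addrC -zE].
  by rewrite /embed addrC; split=> //=; rewrite pS.
have v0 r : row_mx (vp r) (vq r) != 0.
  apply/eqP => E; have := facet_system_neq0 fsP r => /eqP; apply.
  have : v r *m (col_mx S I)^T = 0 by rewrite tr_col_mx mul_mx_row.
  move=> /(congr1 (fun M => M *m invmx (col_mx S I)^T)).
  by rewrite mulmxK ?unitmx_tr // mul0mx.
have [phi [aff totalE]] := bundle_is_total fsB fsQ v0 base fibers Nlm.
exists (invmx (col_mx S I)); first by rewrite unitmx_inv.
exists l, m, u, b, t, a, phi; split=> //.
  move=> x; rewrite BE QE => Bx; have := fibers x Bx.
  congr normally_isomorphic; apply/seteqP; split=> y; first by move=> /totalE[].
  by move=> Fy; apply/totalE.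
apply/seteqP; split=> [_ [z Pz <-]|z].
  rewrite -[_ *m _]hsubmxK; apply/total_row_mx/totalE/fiberP.
  by rewrite -mul_row_col hsubmxK mulmxKV.
rewrite -[z]hsubmxK => /total_row_mx/totalE/fiberP; rewrite -mul_row_col => Pz.
by exists (row_mx (lsubmx z) (rsubmx z) *m col_mx S I); rewrite ?mulmxK.
Qed.

End Bundles.

Theorem proposition5p5 (R : realType) (k n : nat) :
  (forall (B : set 'rV[R]_k) (Q : set 'rV[R]_n) (l m : nat)
          (u : 'I_l -> 'rV[R]_k) (b : 'I_l -> R)
          (t : 'I_m -> 'rV[R]_n) (a : 'I_m -> R)
          (phi : 'I_m -> 'rV[R]_k -> R),
     full_dim_polytope B -> full_dim_polytope Q ->
     facet_description B u b -> facet_description Q t a ->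
     (forall j, affine_fun (phi j)) ->
     (forall x, B x -> normally_isomorphic (fiber_polytope t a phi x) Q) ->
     bundle (total_polytope u b t a phi) B Q)
  /\
  (forall (P : set 'rV[R]_(k + n)) (B : set 'rV[R]_k) (Q : set 'rV[R]_n),
     bundle P B Q ->
     exists (MB : 'M[R]_k) (MQ : 'M[R]_n) (MP : 'M[R]_(k + n)),
       [/\ MB \in unitmx, MQ \in unitmx, MP \in unitmx &
       exists (l m : nat)
              (u : 'I_l -> 'rV[R]_k) (b : 'I_l -> R)
              (t : 'I_m -> 'rV[R]_n) (a : 'I_m -> R)
              (phi : 'I_m -> 'rV[R]_k -> R),
         [/\ facet_description (mx_image MB B) u b,
             facet_description (mx_image MQ Q) t a,
             forall j, affine_fun (phi j),
             forall x, mx_image MB B x ->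
               normally_isomorphic (fiber_polytope t a phi x) (mx_image MQ Q) &
             mx_image MP P = total_polytope u b t a phi]]).
Proof.
split=> [B Q l m u b t a phi fB fQ dB dQ aff fan|P B Q /bundle_change_of_basis].
  have sB := facet_description_system fB.2 dB.
  have sQ := facet_description_system fQ.2 dQ.
  move: dB.1 dQ.1 => BE QE; rewrite BE QE in fB fQ fan *.
  exact: total_bundle.
move=> [MP MPu [l [m [u [b [t [a [phi h]]]]]]]].
exists 1%:M, 1%:M, MP; rewrite !mx_image1; split; rewrite ?unitmx1 //.
by exists l, m, u, b, t, a, phi.
Qed.
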